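(* Let $a_1,\dots,a_n$ be numbers and let $$\mathcal A_n=\begin{pmatrix}a_1&-a_1&0&\cdots&0\\0&a_2&-a_2&\cdots&0\\0&0&a_3&\cdots&0\\\vdots&\vdots&\vdots&\ddots&\vdots\\0&0&0&\cdots&a_n\end{pmatrix}$$ be the $n\times n$ matrix with $(i,i)$ entry $a_i$ for $1\le i\le n$, $(i,i+1)$ entry $-a_i$ for $1\le i\le n-1$, and all other entries zero. Assume $\det\mathcal A_n\ne0$ and that $a_1,\dots,a_n$ are pairwise distinct. Then for every $\alpha\in\mathbb R$ the power $\alpha$ of $\mathcal A_n$ is the matrix $\mathcal A_n^\alpha=(p_{sm})_{s,m=1}^n$ ($s$ the row index, $m$ the column index), where $$p_{sm}=\begin{cases}0&\text{if }m<s,\\[4pt]\displaystyle\prod_{i=s}^{m-1}a_i\cdot\sum_{j=s}^m\frac{a_j^\alpha}{\prod_{i=s,\,i\ne j}^m(a_i-a_j)}&\text{if }s<m,\\[4pt]a_m^\alpha&\text{if }m=s.\end{cases}$$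
   Context: The $a_i$ are real (or complex) numbers. For a nonzero number $a$, $a^\alpha=e^{\alpha\ln a}$ with the principal branch of the logarithm; for an invertible matrix $\mathcal A$, $\mathcal A^\alpha=e^{\alpha\ln\mathcal A}$ with the principal branch of the logarithm. In particular, for a diagonalizable $\mathcal A=PDP^{-1}$ with $D$ diagonal with nonzero entries $d_1,\dots,d_n$, one has $\mathcal A^\alpha=PD^\alpha P^{-1}$ with $D^\alpha=\mathrm{diag}(d_1^\alpha,\dots,d_n^\alpha)$. *)

(* Defs.v *)
From HB Require Import structures.
From mathcomp Require Import all_boot all_order all_algebra.
From mathcomp Require Import complex.
From mathcomp Require Import all_classical all_reals all_analysis.
Set Implicit Arguments.
Unset Strict Implicit.
Unset Printing Implicit Defensive.
Import Order.TTheory GRing.Theory Num.Theory.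
Import numFieldNormedType.Exports.
Local Open Scope classical_set_scope.
Local Open Scope complex_scope.
Local Open Scope ring_scope.

Definition cexp (R : realType) (z : R[i]) : R[i] :=
  (expR (complex.Re z) * cos (complex.Im z))
    +i* (expR (complex.Re z) * sin (complex.Im z)).

(* Principal argument of z != 0, with values in ]-pi, pi]. *)
Definition carg (R : realType) (z : R[i]) : R :=
  let t := acos (complex.Re z / ComplexField.Normc.normc z) in
  if 0 <= complex.Im z then t else - t.

Definition cln (R : realType) (z : R[i]) : R[i] :=
  ln (ComplexField.Normc.normc z) +i* carg z.

(* Only meaningful for z != 0. *)
Definition cpow (R : realType) (z : R[i]) (alpha : R) : R[i] :=
  cexp (alpha%:C * cln z).

(* The limit is taken in the norm topology of 'M[K]_n.  K is kept abstract
   because R[i] receives its topology as a numFieldType. *)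
Definition mxexp (K : numFieldType) (n : nat) (A : 'M[K]_n) : 'M[K]_n :=
  limn (series (fun k : nat => (k`!%:R)^-1 *: A ^+ k)).

(* L is a logarithm of A whose spectrum lies in the range -pi < Im w <= pi of
   the principal scalar logarithm.  As exp is injective on this strip, each
   invertible A has exactly one such L, also when A has negative real
   eigenvalues. *)
Definition is_principal_log (R : realType) (n : nat) (A L : 'M[R[i]]_n) : Prop :=
  mxexp L = A /\
  forall w : R[i], eigenvalue L w -> - pi < complex.Im w <= pi.

(* The default 0 is only reached when A is singular. *)
Definition mxln (R : realType) (n : nat) (A : 'M[R[i]]_n) : 'M[R[i]]_n :=
  xget 0 [set L | is_principal_log A L].

Definition mxpow (R : realType) (n : nat) (A : 'M[R[i]]_n) (alpha : R) :
    'M[R[i]]_n :=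
  mxexp (alpha%:C *: mxln A).

(* Indices run from 0 to n - 1. *)
Definition bidiag_mx (R : realType) (n : nat) (a : 'I_n -> R[i]) : 'M[R[i]]_n :=
  \matrix_(i < n, j < n)
    if j == i then a i else if (j : nat) == i.+1 then - a i else 0.

(* Main.v *)
(* The matrix A is triangular with distinct diagonal entries a_j, and its right
   and left eigenvectors for a_j solve two-term recurrences, hence are explicit
   products.  Normalised to have entry 1 at index j, they form matrices P and Q
   with Q P = 1: eigenvectors for distinct eigenvalues are orthogonal, and by
   triangularity the diagonal entries of Q P reduce to a single term.  So
   A = P diag(a_j) Q, and P diag(f_j) Q has the entries of the theorem with f_j
   in place of a_j^alpha.
     A principal logarithm L of A commutes with exp L = A, hence is
   P diag(l_j) Q for some l_j.  Then exp l_j = a_j with l_j in the principal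
   strip, so l_j = ln a_j, and exp (alpha L) = P diag(a_j^alpha) Q. *)
Require Import Defs.
From HB Require Import structures.
From mathcomp Require Import all_boot all_order all_algebra.
From mathcomp Require Import complex.
From mathcomp Require Import all_classical all_reals all_analysis.
From mathcomp Require Import ring lra zify.
Set Implicit Arguments.
Unset Strict Implicit.
Unset Printing Implicit Defensive.
Import Order.TTheory GRing.Theory Num.Theory.
Import numFieldNormedType.Exports.
Local Open Scope ring_scope.
Local Open Scope complex_scope.
Local Open Scope classical_set_scope.

(** * The scalar exponential and logarithm *)

(** Both [g + f] and [g - f] vanish at 0 and have a nonnegative derivative on [0, b], so both are
    nonnegative there. *)
Lemma normr_le_of_derive (R : realType) (f g df dg : R -> R) (b : R) :
  (forall t : R, is_derive t 1 f (df t)) ->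
  (forall t : R, is_derive t 1 g (dg t)) ->
  f 0 = 0 -> g 0 = 0 -> (forall t : R, 0 <= t <= b -> `|df t| <= dg t) ->
  forall t, 0 <= t <= b -> `|f t| <= g t.
Proof.
move=> fd gd f0 g0 le_d t /andP[t0 tb].
have mono (h dh : R -> R) : (forall t : R, is_derive t 1 h (dh t)) ->
    (forall t : R, 0 <= t <= b -> 0 <= dh t) -> h 0 <= h t.
  move=> hd dh0; have hder s : derivable h s 1 by case: (hd s).
  apply: (@ger0_derive1_ndecr _ h 0 b) => //.
    move=> s; rewrite in_itv/= => /andP[s0 sb].
    by rewrite derive1E (@derive_val _ _ _ _ _ _ _ (hd s)) dh0// !ltW.
  apply: continuous_subspaceT => s.
  by apply/differentiable_continuous/derivable1_diffP.
have := mono (g - f) (fun t => dg t - df t) (fun t => is_deriveB (gd t) (fd t)).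
have := mono (g + f) (fun t => dg t + df t) (fun t => is_deriveD (gd t) (fd t)).
rewrite !fctE f0 g0 !subr0 addr0 => hD hB.
rewrite ler_norml; apply/andP; split.
  rewrite -subr_ge0 opprK addrC; apply: hD => s /le_d; rewrite ler_norml; lra.
rewrite -subr_ge0; apply: hB => s /le_d; rewrite ler_norml; lra.
Qed.

Lemma is_derive_exp_coeff (R : realType) (c t : R) n :
  is_derive t 1 (fun t => exp_coeff (c * t) n.+1) (c * exp_coeff (c * t) n).
Proof.
have -> : (fun t => exp_coeff (c * t) n.+1) =
    horner ((c ^+ n.+1 / n.+1`!%:R) *: 'X^(n.+1)).
  by apply/funext => s; rewrite /exp_coeff/= hornerZ hornerXn exprMn mulrAC.
apply: (is_derive_eq (is_derive_poly _ _)).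
rewrite derivZ derivXn hornerZ hornerMn hornerXn/=.
rewrite /exp_coeff/= exprMn factS natrM.
rewrite -mulr_natl exprS.
by field; rewrite nat1r !pnatr_eq0 -!lt0n fact_gt0.
Qed.

(* The pair (u k, v k) stands for the complex function u k + i v k, so that the
   derivative of the k.+1-st function is x + i y times the k-th one. *)
Lemma iterated_primitive_bound (R : realType) (x y C : R)
    (u v : nat -> R -> R) :
  (forall t : R, 0 <= t <= 1 -> `|u 0%N t| <= C) ->
  (forall t : R, 0 <= t <= 1 -> `|v 0%N t| <= C) ->
  (forall k, u k.+1 0 = 0) -> (forall k, v k.+1 0 = 0) ->
  (forall k (t : R), is_derive t 1 (u k.+1) (x * u k t - y * v k t)) ->
  (forall k (t : R), is_derive t 1 (v k.+1) (x * v k t + y * u k t)) ->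
  forall k t, 0 <= t <= 1 ->
    `|u k t| <= C * exp_coeff ((`|x| + `|y|) * t) k /\
    `|v k t| <= C * exp_coeff ((`|x| + `|y|) * t) k.
Proof.
move=> u0C v0C u0 v0 du dv; set c : R := `|x| + `|y|.
elim=> [|k IH] t t01; first by rewrite /exp_coeff/= divr1 expr0 mulr1; auto.
(* The next majorant has derivative [c] times the current one, and by induction this dominates |x u
   - y v| and |x v + y u|. *)
have dg (s : R) : is_derive s 1 (C \*: (fun t : R => exp_coeff (c * t) k.+1))
    (C * (c * exp_coeff (c * s) k)).
  exact: (is_deriveZ C (is_derive_exp_coeff c s k)).
have g0 : (C \*: (fun t : R => exp_coeff (c * t) k.+1)) 0 = 0.
  rewrite -[LHS]/(C * exp_coeff (c * 0) k.+1).
  by rewrite /exp_coeff/= mulr0 expr0n mul0r mulr0.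
split.
- apply: (normr_le_of_derive (du k) dg (u0 k) g0 _ t01) => s /IH[us vs].
  rewrite (le_trans (ler_normB _ _))// !normrM.
  rewrite mulrCA [leRHS]mulrDl lerD// ler_wpM2l//.
- apply: (normr_le_of_derive (dv k) dg (v0 k) g0 _ t01) => s /IH[us vs].
  rewrite (le_trans (ler_normD _ _))// !normrM.
  rewrite mulrCA [leRHS]mulrDl lerD// ler_wpM2l//.
Qed.

(** Here p_k + i q_k stands for the first k Taylor terms of exp (t (x + i y)) in t, described by
    derivative and value at 0. The remainders on [0, 1] are then successive primitives as in
    [iterated_primitive_bound], taken at t = 1. *)
Lemma cexp_remainder_bound (R : realType) (x y : R) (p q : nat -> {poly R}) :
  p 0%N = 0 -> q 0%N = 0 ->
  (forall k, (p k.+1).[0] = 1) -> (forall k, (q k.+1).[0] = 0) ->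
  (forall k, deriv (p k.+1) = x *: p k - y *: q k) ->
  (forall k, deriv (q k.+1) = x *: q k + y *: p k) ->
  forall k,
    `|expR x * cos y - (p k).[1]| <= expR `|x| * exp_coeff (`|x| + `|y|) k /\
    `|expR x * sin y - (q k).[1]| <= expR `|x| * exp_coeff (`|x| + `|y|) k.
Proof.
move=> p0 q0 p1 q1 dp dq k.
pose u k (t : R) := expR (x * t) * cos (y * t) - (p k).[t].
pose v k (t : R) := expR (x * t) * sin (y * t) - (q k).[t].
have dlin (c t : R) : is_derive t 1 (fun t => c * t) c.
  by apply: is_derive_eq; rewrite -[RHS]mulr1.
have de (t : R) : is_derive t 1 (fun t => expR (x * t)) (x * expR (x * t)).
  apply: (is_derive_eq (is_derive1_comp (is_derive_expR (x * t)) (dlin x t))).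
  exact: mulrC.
have dc (t : R) : is_derive t 1 (fun t => cos (y * t)) (- y * sin (y * t)).
  apply: (is_derive_eq (is_derive1_comp (is_derive_cos (y * t)) (dlin y t))).
  by rewrite mulrC mulrN mulNr.
have ds (t : R) : is_derive t 1 (fun t => sin (y * t)) (y * cos (y * t)).
  apply: (is_derive_eq (is_derive1_comp (is_derive_sin (y * t)) (dlin y t))).
  exact: mulrC.
have du j (t : R) : is_derive t 1 (u j.+1) (x * u j t - y * v j t).
  apply: (is_derive_eq (is_deriveB (is_deriveM (de t) (dc t))
    (is_derive_poly _ t))).
  by rewrite dp /u /v !hornerE /GRing.scale/=; ring.
have dv j (t : R) : is_derive t 1 (v j.+1) (x * v j t + y * u j t).
  apply: (is_derive_eq (is_deriveB (is_deriveM (de t) (ds t))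
    (is_derive_poly _ t))).
  by rewrite dq /u /v !hornerE /GRing.scale/=; ring.
(* For k = 0 the remainder is the whole function; this bound on [0, 1] supplies the constant [C]. *)
have eC (t r : R) : 0 <= t <= 1 -> `|r| <= 1 ->
    `|expR (x * t) * r| <= expR `|x|.
  move=> /andP[t0 t1] r1; rewrite normrM ger0_norm ?expR_ge0//.
  apply: le_trans (ler_piMr (expR_ge0 _) r1) _; rewrite ler_expR.
  apply: le_trans (ler_norm _) _; rewrite normrM (ger0_norm t0).
  exact: ler_piMr.
have := @iterated_primitive_bound R x y (expR `|x|) u v _ _ _ _ du dv k 1 _.
rewrite /u /v !mulr1; apply; rewrite ?ler01 ?lexx//.
- by move=> t t01; rewrite p0 horner0 subr0 eC// cos_max.
- by move=> t t01; rewrite q0 horner0 subr0 eC// sin_max.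
- by move=> j; rewrite p1 !mulr0 expR0 cos0 mulr1 subrr.
- by move=> j; rewrite q1 !mulr0 sin0 mulr0 subrr.
Qed.

Lemma normc_le_add (R : realType) (a b : R) :
  `|a +i* b| <= (`|a| + `|b|)%:C :> R[i].
Proof.
rewrite normc_def lecR /= -[leRHS]ger0_norm ?addr_ge0// -sqrtr_sqr ler_wsqrtr//.
by rewrite sqrrD !real_normK ?num_real// lerD2r lerDl mulrn_wge0// mulr_ge0.
Qed.

(** The remainder is at most a constant times a term of the real exponential series, and these terms
    tend to 0. *)
Lemma cvg_cexp (R : realType) (z : R[i]) :
  let K : numFieldType := R[i] in
  series (fun k : nat => (k`!%:R)^-1 * (z : K) ^+ k) @ \oo --> (cexp z : K).
Proof.
move=> K.
have ReM (a b : R[i]) : complex.Re (a * b) =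
    complex.Re a * complex.Re b - complex.Im a * complex.Im b.
  by case: a b => [? ?] [? ?].
have ImM (a b : R[i]) : complex.Im (a * b) =
    complex.Re a * complex.Im b + complex.Im a * complex.Re b.
  by case: a b => [? ?] [? ?].
(* Real and imaginary parts of the first k terms of exp (t z), as polynomials in t; at t = 1 they
   give the partial sum. *)
pose p k := \poly_(j < k) (complex.Re (z ^+ j) / j`!%:R).
pose q k := \poly_(j < k) (complex.Im (z ^+ j) / j`!%:R).
have ReS j : complex.Re (z ^+ j.+1) =
    complex.Re z * complex.Re (z ^+ j) - complex.Im z * complex.Im (z ^+ j).
  by rewrite exprS ReM.
have ImS j : complex.Im (z ^+ j.+1) =
    complex.Re z * complex.Im (z ^+ j) + complex.Im z * complex.Re (z ^+ j).
  by rewrite exprS ImM.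
have factE j (a : R) : a / j.+1`!%:R *+ j.+1 = a / j`!%:R.
  rewrite factS natrM -mulr_natl; field.
  by rewrite nat1r !pnatr_eq0 -!lt0n fact_gt0.
have bound k : `|cexp z - series (fun k : nat => (k`!%:R)^-1 * z ^+ k) k| <=
    ((expR `|complex.Re z| *+ 2) *
      exp_coeff (`|complex.Re z| + `|complex.Im z|) k)%:C.
  have -> : series (fun k : nat => (k`!%:R)^-1 * z ^+ k) k
      = (p k).[1] +i* (q k).[1].
    rewrite /series/= !horner_poly big_mkord.
    elim: k => [|k IH]; first by rewrite !big_ord0.
    rewrite !big_ord_recr/= IH !expr1n !mulr1.
    have -> : (k`!%:R)^-1 = ((k`!%:R)^-1)%:C :> R[i].
      by rewrite fmorphV/= rmorph_nat.
    case: (z ^+ k) => a b /=; apply/eqP; rewrite eq_complex/=.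
    by rewrite !mul0r subr0 addr0 ![_^-1 * _]mulrC !eqxx.
  have [|||||| le1 le2] := @cexp_remainder_bound R (complex.Re z)
    (complex.Im z) p q _ _ _ _ _ _ k.
  - by apply/polyP => j; rewrite coef_poly coef0.
  - by apply/polyP => j; rewrite coef_poly coef0.
  - by move=> j; rewrite horner_coef0 coef_poly/= divr1.
  - by move=> j; rewrite horner_coef0 coef_poly/= mul0r.
  - move=> k'; apply/polyP => j.
    rewrite coef_deriv coefB !coefZ !coef_poly ltnS; case: ifP => _.
      by rewrite factE ReS mulrBl !mulrA.
    by rewrite !mulr0 subrr mul0rn.
  - move=> k'; apply/polyP => j.
    rewrite coef_deriv coefD !coefZ !coef_poly ltnS; case: ifP => _.
      by rewrite factE ImS mulrDl !mulrA.
    by rewrite !mulr0 addr0 mul0rn.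
  apply: le_trans (normc_le_add _ _) _.
  by rewrite lecR mulrnAl mulr2n lerD.
apply/cvgrPdist_lt => e e0.
(* A positive element of [R[i]] is real, so the comparison can take place in [R]. *)
have eE : (complex.Re e)%:C = e by rewrite RRe_real ?gtr0_real.
have e0' : 0 < complex.Re e by rewrite -ltcR eE.
have lim0 : (fun k => (expR `|complex.Re z| *+ 2) *
    exp_coeff (`|complex.Re z| + `|complex.Im z|) k) @ \oo --> 0.
  rewrite -(mulr0 (expR `|complex.Re z| *+ 2)).
  by apply: cvgM; [exact: cvg_cst|exact: cvg_exp_coeff].
move/cvgrPdist_lt : lim0 => /(_ _ e0'); apply: filterS => k.
rewrite sub0r normrN => lte; apply: le_lt_trans (bound k) _.
by rewrite -eE ltcR (le_lt_trans (ler_norm _)).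
Qed.

Lemma normc_cexp (R : realType) (z : R[i]) :
  ComplexField.Normc.normc (cexp z) = expR (complex.Re z).
Proof.
rewrite /cexp /= !exprMn -mulrDr cos2Dsin2 mulr1 sqrtr_sqr ger0_norm//.
Qed.

(** The modulus exp (Re z) returns the real part. Dividing it out leaves acos (cos y), which is |y|
    on the strip, and the sign of sin y restores the sign of y. *)
Lemma cexpK (R : realType) (z : R[i]) :
  - pi < complex.Im z <= pi -> cln (cexp z) = z.
Proof.
move=> /andP[im_gt im_le]; rewrite /cln normc_cexp expRK /carg normc_cexp.
rewrite [X in acos X]mulrAC mulfV ?mul1r; last by rewrite gt_eqF ?expR_gt0.
rewrite /= pmulr_rge0 ?expR_gt0//; case: z im_gt im_le => x y /= y_gt y_le.
congr Complex; have [y0|y0] := leP 0 y.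
  by rewrite sin_ge0_pi ?y0// cosK// in_itv/= y0.
(* Since y > -pi strictly, sin y < 0 and [carg] takes its negative branch; at y = -pi the sine would
   vanish. *)
rewrite leNgt -[y]opprK sinN oppr_lt0 sin_gt0_pi/=; last first.
  by rewrite oppr_gt0 y0 ltrNl.
by rewrite opprK cosKN ?opprK ?ltW.
Qed.

Lemma normc_gt0 (R : realType) (z : R[i]) :
  z != 0 -> 0 < ComplexField.Normc.normc z.
Proof.
move=> z0; rewrite lt_def; apply/andP; split.
  by apply: contraNneq z0 => /ComplexField.Normc.eq0_normc ->.
by case: z {z0} => a b; exact: sqrtr_ge0.
Qed.

Lemma carg_polar (R : realType) (z : R[i]) : z != 0 ->
  - pi < carg z <= pi /\
  z = (ComplexField.Normc.normc z * cos (carg z)) +i*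
      (ComplexField.Normc.normc z * sin (carg z)).
Proof.
move=> z0; pose r := ComplexField.Normc.normc z; pose s := complex.Re z / r.
case: z z0 @r @s => a b z0 r s.
have r2 : r ^+ 2 = a ^+ 2 + b ^+ 2 by rewrite sqr_sqrtr ?addr_ge0 ?sqr_ge0.
have r_gt0 : 0 < r by exact: normc_gt0.
have rN0 : r != 0 by rewrite gt_eqF.
have s1 : -1 <= s <= 1.
  rewrite -ler_norml normrM normfV (gtr0_norm r_gt0) ler_pdivrMr// mul1r.
  by rewrite -sqrtr_sqr ler_wsqrtr// lerDl sqr_ge0.
(* The sine of an [acos] is nonnegative, so only |b| is recovered; the case split in [carg] supplies
   the sign. *)
have sinE : r * sin (acos s) = `|b|.
  rewrite sin_acos// -{1}(gtr0_norm r_gt0) -sqrtr_sqr -sqrtrM ?sqr_ge0//.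
  rewrite mulrBr mulr1 -exprMn /s/= mulrC mulfVK//.
  by rewrite r2 addrAC subrr add0r sqrtr_sqr.
have cosE : r * cos (acos s) = a by rewrite acosK ?in_itv// mulrC mulfVK.
rewrite /carg -/r -/s /=; have [b0|b0] := leP 0 b.
  rewrite acos_lepi// andbT cosE sinE ger0_norm//; split=> //.
  by rewrite (lt_le_trans _ (acos_ge0 s1))// oppr_lt0 pi_gt0.
rewrite cosN sinN mulrN cosE sinE ltr0_norm// opprK; split=> //.
rewrite ltrN2 (le_trans _ (pi_ge0 R)) ?oppr_le0 ?acos_ge0// andbT.
rewrite lt_neqAle acos_lepi// andbT.
(* The value pi would force sin = 0, hence b = 0, against b < 0; so the lower end -pi is not
   attained. *)
apply: contraTneq b0 => spi; move: sinE; rewrite spi sinpi mulr0 => /esym/eqP.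
by rewrite normr_eq0 => /eqP ->; rewrite ltxx.
Qed.

Lemma clnK (R : realType) (z : R[i]) : z != 0 -> cexp (cln z) = z.
Proof.
move=> z0; rewrite [RHS](carg_polar z0).2 /cexp /cln /= lnK// posrE.
exact: normc_gt0.
Qed.

(** * The matrix exponential *)

(** A neighbourhood of a matrix contains a box of entrywise neighbourhoods, and a filter is closed
    under the finite intersection over all entries. *)
Lemma cvg_mx (T : ptopologicalType) (I : Type) (F : set_system I) m n
    (f : I -> 'M[T]_(m, n)) (A : 'M[T]_(m, n)) {FF : Filter F} :
  (forall i j, (fun x => f x i j) @ F --> A i j) -> f @ F --> A.
Proof.
move=> cvgf B [P PA sPB].
apply: filterS
  (_ : forall x, (forall ij, P ij.1 ij.2 (f x ij.1 ij.2)) -> B (f x)) _.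
  by move=> x Px; apply: sPB => i j; exact: (Px (i, j)).
by apply: filter_forall => -[i j] /=; apply: cvgf; exact: PA.
Qed.

Lemma cvg_mx_entry (K : numFieldType) (I : Type) (F : set_system I) m n
    (f : I -> 'M[K]_(m, n)) (A : 'M[K]_(m, n)) i j {FF : Filter F} :
  f @ F --> A -> (fun x => f x i j) @ F --> A i j.
Proof.
move=> cvgf.
exact: (@cvg_comp _ _ _ f (fun M : 'M[K]_(m, n) => M i j) F (nbhs A) _ cvgf
  (@coord_continuous K m n i j A)).
Qed.

Lemma cvg_mx_unique (K : numFieldType) (I : Type) (F : set_system I) m n
    (f : I -> 'M[K]_(m, n)) (A B : 'M[K]_(m, n)) {FF : ProperFilter F} :
  f @ F --> A -> f @ F --> B -> A = B.
Proof.
move=> fA fB; apply/matrixP => i j.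
apply: (@cvg_unique K (@norm_hausdorff K K^o) ((fun x => f x i j) @ F)).
  exact: cvg_mx_entry fA.
exact: cvg_mx_entry fB.
Qed.

Lemma cvg_mulmx (K : numFieldType) (I : Type) (F : set_system I) m n p q
    (f : I -> 'M[K]_(n, p)) (A : 'M[K]_(n, p)) (B : 'M[K]_(m, n))
    (C : 'M[K]_(p, q)) {FF : Filter F} :
  f @ F --> A -> (fun x => B *m f x *m C) @ F --> B *m A *m C.
Proof.
move=> fA; apply: cvg_mx => i j.
have -> : (fun x => (B *m f x *m C) i j) =
    (fun x => \sum_(k : 'I_p) (\sum_(l : 'I_n) B i l * f x l k) * C k j).
  by apply/funext => x; rewrite mxE; apply: eq_bigr => k _; rewrite mxE.
rewrite mxE.
apply: cvg_big => [|k _]; first exact: add_continuous.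
apply: cvgM; last exact: cvg_cst.
rewrite mxE; apply: cvg_big => [|l _]; first exact: add_continuous.
apply: cvgM; first exact: cvg_cst.
exact: cvg_mx_entry.
Qed.

Lemma mxexp_cvg (K : numFieldType) n (L A : 'M[K]_n) :
  series (fun k : nat => (k`!%:R)^-1 *: L ^+ k) @ \oo --> A -> mxexp L = A.
Proof.
move=> LA; apply: (cvg_mx_unique (F := \oo) _ LA).
by apply/cvg_ex; exists A.
Qed.

(* If the series diverged, its lim would be the default point 0 of 'M_n. *)
Lemma mxexp_comm (K : numFieldType) n (L : 'M[K]_n) :
  L *m mxexp L = mxexp L *m L.
Proof.
set f := series (fun k : nat => (k`!%:R)^-1 *: L ^+ k).
have [cvf|ncvf] := pselect (cvgn f); last first.
  have -> : mxexp L = 0.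
    rewrite /mxexp /lim /lim_in getPN; last first.
      by move=> A fA; apply: ncvf; apply/cvg_ex; exists A.
    by apply/matrixP => i j; rewrite !mxE.
  by rewrite mulmx0 mul0mx.
have comm k : L *m f k = f k *m L.
  rewrite /f /series/= mulmx_sumr mulmx_suml; apply: eq_bigr => i _.
  by rewrite -scalemxAl -scalemxAr; congr (_ *: _); exact: commrX.
(* Both products are limits of one sequence; the factors [1%:M] give it the two-sided shape of
   [cvg_mulmx]. *)
apply: (cvg_mx_unique (F := \oo) (f := fun k => L *m f k *m 1%:M)).
  by rewrite -[L *m mxexp L]mulmx1; exact: cvg_mulmx cvf.
have -> : (fun k => L *m f k *m 1%:M) = (fun k => 1%:M *m f k *m L).
  by apply/funext => k; rewrite mulmx1 mul1mx comm.
by rewrite -[mxexp L]mul1mx; exact: cvg_mulmx cvf.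
Qed.

Lemma expr_conj_diag (K : fieldType) n (P Q : 'M[K]_n) (l : 'I_n -> K) k :
  Q *m P = 1%:M ->
  (P *m diag_mx (\row_j l j) *m Q) ^+ k = P *m diag_mx (\row_j (l j ^+ k)) *m Q.
Proof.
move=> QP1; elim: k => [|k IH].
  rewrite expr0 (_ : diag_mx _ = 1%:M) ?mulmx1 ?(mulmx1C QP1)//.
  by rewrite -diag_const_mx; congr diag_mx; apply/rowP => j; rewrite !mxE expr0.
rewrite exprS IH -mulmxE -!mulmxA [Q *m _]mulmxA QP1 mul1mx; congr (_ *m _).
rewrite mulmxA mulmx_diag; congr (diag_mx _ *m _).
by apply/rowP => j; rewrite !mxE exprS.
Qed.

(** As Q P = 1, each partial sum of the matrix series is P diag(scalar partial sums) Q, and the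
    limit is taken entrywise. *)
Lemma mxexp_conj_diag (K : numFieldType) n (P Q : 'M[K]_n) (l e : 'I_n -> K) :
  Q *m P = 1%:M ->
  (forall j, series (fun k : nat => (k`!%:R)^-1 * l j ^+ k) @ \oo --> e j) ->
  mxexp (P *m diag_mx (\row_j l j) *m Q) = P *m diag_mx (\row_j e j) *m Q.
Proof.
move=> QP1 cvgl; apply: mxexp_cvg.
pose S j := series (fun k : nat => (k`!%:R)^-1 * l j ^+ k).
have -> : series (fun k : nat =>
      (k`!%:R)^-1 *: (P *m diag_mx (\row_j l j) *m Q) ^+ k) =
    (fun N => P *m diag_mx (\row_j S j N) *m Q).
  apply/funext => N; rewrite /series/=.
  under eq_bigr do rewrite expr_conj_diag// scalemxAl scalemxAr.
  rewrite -mulmx_suml -mulmx_sumr; congr (_ *m _ *m _).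
  apply/matrixP => i j; rewrite summxE !mxE /S /series/= -sumrMnl.
  by apply: eq_bigr => k _; rewrite !mxE mulrnAr.
apply: cvg_mulmx; apply: cvg_mx => i j.
under eq_fun do rewrite !mxE.
by rewrite !mxE; case: (i == j); rewrite ?mulr1n; [exact: cvgl|exact: cvg_cst].
Qed.

Lemma mxexp_conj_diagC (R : realType) n (P Q : 'M[R[i]]_n) (l : 'I_n -> R[i]) :
  Q *m P = 1%:M ->
  mxexp (P *m diag_mx (\row_j l j) *m Q) =
  P *m diag_mx (\row_j cexp (l j)) *m Q.
Proof. by move=> QP1; apply: mxexp_conj_diag => // j; exact: cvg_cexp. Qed.

(** * Powers of diagonalisable matrices *)

(** Entry (i, j) of the commutation relation says (d_i - d_j) X_ij = 0. *)
Lemma diag_of_comm_diag (F : fieldType) n (d : 'I_n -> F) (X : 'M[F]_n) :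
  injective d ->
  diag_mx (\row_j d j) *m X = X *m diag_mx (\row_j d j) ->
  X = diag_mx (\row_j X j j).
Proof.
move=> d_inj dX; apply/matrixP => i j; rewrite !mxE.
have [->|ij] := eqVneq i j; first by rewrite mulr1n.
move/matrixP : dX => /(_ i j); rewrite mul_diag_mx mul_mx_diag !mxE => /eqP.
rewrite mulrC -subr_eq0 -mulrBr mulf_eq0 subr_eq0 (inj_eq d_inj) (negPf ij).
by rewrite orbF mulr0n => /eqP.
Qed.

(** Conjugating back, Q L P commutes with diag(d_j) and is therefore diagonal. *)
Lemma comm_conj_diag (F : fieldType) n (d : 'I_n -> F) (P Q L : 'M[F]_n) :
  injective d -> Q *m P = 1%:M ->
  GRing.comm (P *m diag_mx (\row_j d j) *m Q) L ->
  exists l : 'I_n -> F, L = P *m diag_mx (\row_j l j) *m Q.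
Proof.
move=> d_inj QP1 comL; have PQ1 := mulmx1C QP1.
exists (fun j => (Q *m L *m P) j j).
rewrite -(diag_of_comm_diag d_inj).
  by rewrite !mulmxA PQ1 mul1mx -mulmxA PQ1 mulmx1.
have := congr1 (fun M => Q *m M *m P) comL.
rewrite /= -!mulmxE !mulmxA QP1 mul1mx => ->.
by rewrite -!mulmxA QP1 mulmx1.
Qed.

Lemma conj_diag_inj (K : fieldType) n (P Q : 'M[K]_n) (f g : 'I_n -> K) :
  Q *m P = 1%:M ->
  P *m diag_mx (\row_j f j) *m Q = P *m diag_mx (\row_j g j) *m Q -> f =1 g.
Proof.
move=> QP1 /(congr1 (fun M => Q *m M *m P)).
rewrite /= !mulmxA QP1 !mul1mx -!mulmxA QP1 !mulmx1 => /matrixP E j.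
by have := E j j; rewrite !mxE eqxx !mulr1n.
Qed.

(** Eigenvectors are row vectors here: v P is one for the diagonal matrix, and any nonzero entry of
    it identifies j. Conversely, row j of Q is an eigenvector for f_j. *)
Lemma eigenvalue_conj_diag (K : fieldType) n (P Q : 'M[K]_n) (f : 'I_n -> K) w :
  Q *m P = 1%:M ->
  eigenvalue (P *m diag_mx (\row_j f j) *m Q) w <-> exists j, w = f j.
Proof.
move=> QP1; have PQ1 := mulmx1C QP1; split.
  move=> /eigenvalueP[v vE vN0].
  have uN0 : v *m P != 0.
    by apply: contraNneq vN0 => vP0; rewrite -[v]mulmx1 -PQ1 mulmxA vP0 mul0mx.
  have /rV0Pn[j uj] := uN0; exists j.
  have := congr1 (fun x => (x *m P) 0 j) vE.
  rewrite /= -!mulmxA QP1 mulmx1 mulmxA mul_mx_diag -scalemxAl !mxE mulrC.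
  by move=> wf; apply/esym/(mulIf uj); rewrite mxE.
move=> [j ->]; apply/eigenvalueP; exists (row j Q).
  rewrite -row_mul !mulmxA QP1 mul1mx; apply/rowP => m.
  by rewrite mul_diag_mx !mxE.
(* A zero row j of Q would make the entry (j, j) of Q P equal to 0 instead of 1. *)
apply/eqP => Qj0; have := congr1 (fun M : 'M[K]_n => M j j) QP1.
rewrite !mxE eqxx big1 => [/esym/eqP|k _]; first by rewrite oner_eq0.
by have /rowP/(_ k) := Qj0; rewrite !mxE => ->; rewrite mul0r.
Qed.

(** [xget] picks an unspecified member of the set, so the candidate has to be shown a principal
    logarithm and the only one. *)
Lemma mxln_conj_diag (R : realType) n (P Q : 'M[R[i]]_n) (d : 'I_n -> R[i]) :
  injective d -> (forall j, d j != 0) -> Q *m P = 1%:M ->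
  mxln (P *m diag_mx (\row_j d j) *m Q) = P *m diag_mx (\row_j cln (d j)) *m Q.
Proof.
move=> d_inj d0 QP1; apply: xget_unique.
  split.
    rewrite mxexp_conj_diagC//; congr (_ *m diag_mx _ *m _).
    by apply/rowP => j; rewrite !mxE clnK.
  by move=> w /(eigenvalue_conj_diag _ _ QP1)[j ->]; case: (carg_polar (d0 j)).
move=> L [expL specL].
have [l lE] := comm_conj_diag d_inj QP1
  (etrans (congr1 (fun M => M *m L) (esym expL))
    (etrans (esym (mxexp_comm L)) (congr1 (mulmx L) expL))).
have lj j : cexp (l j) = d j.
  by move: expL; rewrite lE mxexp_conj_diagC// => /(conj_diag_inj QP1)/(_ j).
rewrite lE; congr (_ *m diag_mx _ *m _); apply/rowP => j; rewrite !mxE -lj.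
rewrite cexpK//; apply: specL; rewrite lE.
by apply/(eigenvalue_conj_diag _ _ QP1); exists j.
Qed.

Lemma mxpow_conj_diag (R : realType) n (P Q : 'M[R[i]]_n) (d : 'I_n -> R[i])
    (alpha : R) :
  injective d -> (forall j, d j != 0) -> Q *m P = 1%:M ->
  mxpow (P *m diag_mx (\row_j d j) *m Q) alpha =
  P *m diag_mx (\row_j cpow (d j) alpha) *m Q.
Proof.
move=> d_inj d0 QP1; rewrite /mxpow mxln_conj_diag// scalemxAl scalemxAr.
have -> : alpha%:C *: diag_mx (\row_j cln (d j)) =
    diag_mx (\row_j (alpha%:C * cln (d j))).
  by apply/matrixP => i j; rewrite !mxE mulrnAr.
exact: mxexp_conj_diagC.
Qed.

(** * Eigenvectors of a bidiagonal matrix *)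

Section bidiagonal_eigenvectors.
Context {F : fieldType} {n : nat} (a : 'I_n -> F).
Context (a_inj : injective a).

(** Column j solves a_i (x_i - x_(i+1)) = a_j x_i upwards from x_j = 1, each step contributing the
    factor a_i / (a_i - a_j). *)
Definition bidiag_right_eigmx : 'M[F]_n := \matrix_(i, j)
  if (i <= j)%N then (\prod_(k < n | (i <= k < j)%N) a k) /
                     (\prod_(k < n | (i <= k < j)%N) (a k - a j))
  else 0.

(** Row j solves a_m y_m - a_(m-1) y_(m-1) = a_j y_m from y_j = 1. The factors are a_(m-1) / (a_m -
    a_j), whence the ranges of the two products differ by a shift. *)
Definition bidiag_left_eigmx : 'M[F]_n := \matrix_(j, m)
  if (j <= m)%N then (\prod_(k < n | (j <= k < m)%N) a k) /
                     (\prod_(k < n | (j < k <= m)%N) (a k - a j))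
  else 0.

Local Notation P := bidiag_right_eigmx.
Local Notation Q := bidiag_left_eigmx.

Context (A : 'M[F]_n).
Context (A_diag : forall i, A i i = a i).
Context (A_superdiag : forall i j : 'I_n, j = i.+1 :> nat -> A i j = - a i).
Context (A_other : forall i j : 'I_n,
  j != i :> nat -> j != i.+1 :> nat -> A i j = 0).

Lemma bidiag_right_eigmxP : A *m P = P *m diag_mx (\row_j a j).
Proof.
apply/matrixP => i j; rewrite mul_mx_diag !mxE (bigD1 i)//= A_diag.
have P0 (k : 'I_n) : (j < k)%N -> P k j = 0.
  by move=> lt_jk; rewrite mxE leqNgt lt_jk.
have [ij|ji|/val_inj eij] := ltngtP i j; last 2 first.
- rewrite P0// mulr0 add0r mul0r big1// => k ki; have [kltj|] := leqP k j.
    by rewrite A_other ?mul0r//; lia.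
  by move=> /P0 ->; rewrite mulr0.
- rewrite {i}eij big1 ?addr0; last first.
    move=> k kj; have [|/P0 ->] := leqP k j; last by rewrite mulr0.
    by move=> kltj; rewrite A_other ?mul0r//; move: kj; rewrite -val_eqE/=; lia.
  rewrite mxE leqnn mulrC.
  by rewrite !big_pred0 ?divr1// => k; lia.
have si_lt : (i.+1 < n)%N by exact: leq_ltn_trans ij (ltn_ord j).
pose si := Ordinal si_lt.
rewrite (bigD1 si)/=; last by rewrite -val_eqE/=; lia.
rewrite (A_superdiag (i := i) (j := si))// big1 ?addr0; last first.
  move=> k /andP[ki ksi]; rewrite A_other ?mul0r//;
    by move: ki ksi; rewrite -!val_eqE/=; lia.
rewrite !mxE (ltnW ij) /= ij.
(* Splitting off k = i expresses entry i of the eigenvector through entry i + 1, which is the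
   recurrence. *)
have E (f : 'I_n -> F) : \prod_(k < n | (i <= k < j)%N) f k =
    f i * \prod_(k < n | (i < k < j)%N) f k.
  rewrite (bigD1 i)/= ?leqnn//; congr (_ * _); apply: eq_bigl => k.
  by rewrite -val_eqE/=; lia.
rewrite !E invfM.
have aij : a i - a j != 0.
  by rewrite subr_eq0 (inj_eq a_inj) -val_eqE/= ltn_eqF.
set x := \prod_(_ < _ | _) _; set y := (\prod_(_ < _ | _) _)^-1.
by field.
Qed.

Lemma bidiag_left_eigmxP : Q *m A = diag_mx (\row_j a j) *m Q.
Proof.
apply/matrixP => j m; rewrite mul_diag_mx !mxE (bigD1 m)//= A_diag.
have Q0 (k : 'I_n) : (k < j)%N -> Q j k = 0.
  by move=> lt_jk; rewrite mxE leqNgt lt_jk.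
have [jm|mj|/val_inj ejm] := ltngtP j m; last 2 first.
- rewrite Q0// mulr0 mul0r add0r big1// => k km; have [kltj|] := leqP j k.
    by rewrite A_other ?mulr0//; lia.
  by move=> /Q0 ->; rewrite mul0r.
- rewrite -{m}ejm big1 ?addr0; last first.
    move=> k kj; have [|/Q0 ->] := leqP j k; last by rewrite mul0r.
    by move=> kltj; rewrite A_other ?mulr0//; move: kj; rewrite -val_eqE/=; lia.
  rewrite mxE leqnn mulrC.
  by rewrite !big_pred0 ?divr1// => k; lia.
(* From j < m it follows that m > 0, so [m.-1] is a true predecessor. *)
have pm_lt : (m.-1 < n)%N by exact: leq_ltn_trans (leq_pred _) (ltn_ord m).
pose pm := Ordinal pm_lt.
have mE : m = pm.+1 :> nat by rewrite /=; lia.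
rewrite (bigD1 pm)/=; last by rewrite -val_eqE/=; lia.
rewrite (A_superdiag mE) big1 ?addr0; last first.
  move=> k /andP[km kpm]; rewrite A_other ?mulr0//;
    by move: km kpm; rewrite -!val_eqE/=; lia.
rewrite !mxE (ltnW jm) (_ : (j <= pm)%N) /=; last by lia.
have -> : \prod_(k < n | (j <= k < m)%N) a k =
    a pm * \prod_(k < n | (j <= k < m.-1)%N) a k.
  rewrite (bigD1 pm)/=; last by lia.
  by congr (_ * _); apply: eq_bigl => k; rewrite -val_eqE/=; lia.
have -> : \prod_(k < n | (j < k <= m)%N) (a k - a j) =
    (a m - a j) * \prod_(k < n | (j < k <= m.-1)%N) (a k - a j).
  rewrite (bigD1 m)/=; last by lia.
  by congr (_ * _); apply: eq_bigl => k; rewrite -val_eqE/=; lia.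
rewrite invfM.
have amj : a m - a j != 0.
  by rewrite subr_eq0 (inj_eq a_inj) -val_eqE/= gtn_eqF.
set x := \prod_(_ < _ | _) _; set y := (\prod_(_ < _ | _) _)^-1.
by field.
Qed.

Lemma bidiag_left_right_eigmx : Q *m P = 1%:M.
Proof.
rewrite (@diag_of_comm_diag _ _ a (Q *m P) a_inj); last first.
  by rewrite mulmxA -bidiag_left_eigmxP -!mulmxA bidiag_right_eigmxP.
rewrite -diag_const_mx; congr diag_mx; apply/rowP => j; rewrite !mxE.
rewrite (bigD1 j)//= big1 ?addr0 => [|k kj].
  by rewrite !mxE leqnn !big_pred0 ?divr1 ?mulr1// => k; lia.
rewrite !mxE; have [jk|] := leqP j k; last by rewrite mul0r.
rewrite (_ : (k <= j)%N = false) ?mulr0//.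
by move: kj; rewrite -val_eqE/=; lia.
Qed.

Lemma bidiag_eigmxE : A = P *m diag_mx (\row_j a j) *m Q.
Proof.
rewrite -bidiag_right_eigmxP -mulmxA.
by rewrite (mulmx1C bidiag_left_right_eigmx) mulmx1.
Qed.

Lemma conj_bidiag_eigmxE (f : 'I_n -> F) :
  P *m diag_mx (\row_j f j) *m Q = \matrix_(s, m)
    if (m < s)%N then 0
    else if (s < m)%N then
      (\prod_(i < n | (s <= i < m)%N) a i) *
      (\sum_(j < n | (s <= j <= m)%N)
         f j / (\prod_(i < n | (s <= i <= m)%N && (i != j)) (a i - a j)))
    else f m.
Proof.
apply/matrixP => s m; rewrite !mxE.
(* The product formula is proved for all s and m. For m < s its sum is empty, and for s = m only j =
   s is left, with empty products. *)
transitivity ((\prod_(i < n | (s <= i < m)%N) a i) *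
    (\sum_(j < n | (s <= j <= m)%N)
       f j / (\prod_(i < n | (s <= i <= m)%N && (i != j)) (a i - a j)))).
  rewrite mulr_sumr [RHS]big_mkcond; apply: eq_bigr => j _.
  rewrite mul_mx_diag !mxE.
  have [sj|js] := leqP s j; last by rewrite !mul0r.
  have [jm|mj] /= := leqP j m; last by rewrite mulr0.
  (* For s <= j <= m the numerators of P_sj and Q_jm join at j to the range [s, m), while their
     denominators cover [s, m] without j. *)
  have -> : \prod_(i < n | (s <= i < m)%N) a i =
      \prod_(i < n | (s <= i < j)%N) a i * \prod_(i < n | (j <= i < m)%N) a i.
    rewrite (bigID (fun i : 'I_n => (i < j)%N))/=.
    by congr (_ * _); apply: eq_bigl => i; lia.
  have -> : \prod_(i < n | (s <= i <= m)%N && (i != j)) (a i - a j) =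
      \prod_(i < n | (s <= i < j)%N) (a i - a j) *
      \prod_(i < n | (j < i <= m)%N) (a i - a j).
    rewrite (bigID (fun i : 'I_n => (i < j)%N))/=.
    by congr (_ * _); apply: eq_bigl => i; rewrite -val_eqE/=; lia.
  by rewrite invfM; ring.
case: ltngtP => // [ms|/val_inj ->].
  by rewrite [X in _ * X]big_pred0 ?mulr0// => j; lia.
rewrite big_pred0 ?mul1r => [|j]; last by lia.
rewrite (big_pred1 s) => [|j]; last by rewrite -[RHS]val_eqE [RHS]eqn_leq andbC.
by rewrite big_pred0 ?divr1// => j; rewrite -val_eqE/=; lia.
Qed.

End bidiagonal_eigenvectors.

Theorem theorem7 (R : realType) (n : nat) (a : 'I_n -> R[i])
    (det_neq0 : \det (bidiag_mx a) != 0) (a_inj : injective a) (alpha : R) :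
  mxpow (bidiag_mx a) alpha =
  \matrix_(s < n, m < n)
    if (m < s)%N then 0
    else if (s < m)%N then
      (\prod_(i < n | (s <= i < m)%N) a i) *
      (\sum_(j < n | (s <= j <= m)%N)
         cpow (a j) alpha /
         (\prod_(i < n | (s <= i <= m)%N && (i != j)) (a i - a j)))
    else cpow (a m) alpha.
Proof.
have A_diag i : bidiag_mx a i i = a i by rewrite mxE eqxx.
have A_superdiag (i j : 'I_n) : j = i.+1 :> nat -> bidiag_mx a i j = - a i.
  by move=> ji; rewrite mxE -val_eqE/= ji eqxx gtn_eqF.
have A_other (i j : 'I_n) :
    j != i :> nat -> j != i.+1 :> nat -> bidiag_mx a i j = 0.
  by move=> ji jsi; rewrite mxE -val_eqE/= (negPf ji) (negPf jsi).
have a0 j : a j != 0.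
  (* [is_trig_mx] means lower triangular, hence the transpose; the determinant is then the product
     of the a_j. *)
  have trig : is_trig_mx (bidiag_mx a)^T.
    apply/is_trig_mxP => i k ik; rewrite mxE A_other ?ltn_eqF//.
    exact: ltn_trans ik _.
  move: det_neq0; rewrite -det_tr det_trig// => /prodf_neq0/(_ j isT).
  by rewrite mxE A_diag.
rewrite (bidiag_eigmxE a_inj A_diag A_superdiag A_other).
rewrite (mxpow_conj_diag _ a_inj a0
  (bidiag_left_right_eigmx a_inj A_diag A_superdiag A_other)).
exact: conj_bidiag_eigmxE.
Qed.
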